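(* Let $n\ge 4$ and let $\mathcal{G}=\{G_1,G_2,\ldots,G_n\}$ be a family of graphs on the same vertex set $[n]$ such that $\rho(G_i)>n-2$ for every $i=1,\ldots,n$. Then $\mathcal{G}$ admits a rainbow Hamiltonian cycle, unless $G_1=G_2=\cdots=G_n\cong K_1\vee(K_{n-2}\cup K_1)$.
   Context: $\rho(G)$ is the spectral radius (largest eigenvalue) of the adjacency matrix of $G$. $\vee$ denotes the join and $\cup$ the disjoint union of graphs; $K_1\vee(K_{n-2}\cup K_1)$ is the graph consisting of $K_{n-1}$ plus one extra vertex of degree 1 adjacent to a vertex of the $K_{n-1}$. $G_i=G_j$ means equal vertex and edge sets (not merely isomorphic). A rainbow Hamiltonian cycle in $\mathcal{G}$ is a Hamiltonian cycle on the common vertex set whose $n$ edges can be labeled $e_1,\ldots,e_n$ with $e_i\in E(G_i)$ for each $i$. *)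

(* Defs.v *)
From HB Require Import structures.
From mathcomp Require Import all_boot all_order all_algebra all_fingroup.
From mathcomp Require Import polyrcf.
From mathcomp Require Import reals.
Set Implicit Arguments. Unset Strict Implicit. Unset Printing Implicit Defensive.
Import Order.TTheory GRing.Theory Num.Theory.
Local Open Scope ring_scope.

Definition is_graph (n : nat) (E : {set {set 'I_n}}) : Prop :=
  forall e, e \in E -> #|e| = 2%N.

Definition adjacent (n : nat) (E : {set {set 'I_n}}) (i j : 'I_n) : bool :=
  [set i; j] \in E.

Definition adj_mx (R : realType) (n : nat) (E : {set {set 'I_n}}) : 'M[R]_n :=
  \matrix_(i, j) (adjacent E i j)%:R.

(* Spectral radius = largest (real) eigenvalue of the (symmetric) adjacency
   matrix, i.e. the largest real root of its characteristic polynomial.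
   (rootsR lists all real roots; the max is taken with default 0, which is
   harmless since for a graph the largest eigenvalue is >= 0.) *)
Definition spec_rad (R : realType) (n : nat) (E : {set {set 'I_n}}) : R :=
  \big[Num.max/0]_(x <- rootsR (char_poly (adj_mx R E))) x.

(* Rainbow Hamiltonian cycle: a cyclic ordering v of all vertices, and a
   bijection s from the n cycle edges to the n graphs, the k-th cycle edge
   {v k, v (k+1 mod n)} lying in G (s k). *)
Definition rainbow_ham_cycle (n : nat) (G : 'I_n -> {set {set 'I_n}}) : Prop :=
  exists (v s : {perm 'I_n}),
    forall k : 'I_n,
      [set v k; v (ordS k)] \in G (s k).

(* K_1 \/ (K_{n-2} u K_1): a clique on {0,...,n-2} plus the vertex n-1
   adjacent only to vertex 0. *)
Definition pendant_clique (n : nat) : {set {set 'I_n}} :=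
  [set e : {set 'I_n} | (#|e| == 2%N) &&
     ([forall x in e, (x < n.-1)%N] ||
      [forall x in e, (val x == 0%N) || (val x == n.-1)])].

Definition graph_iso (n : nat) (E F : {set {set 'I_n}}) : Prop :=
  exists p : {perm 'I_n}, E = [set p @: e | e : {set 'I_n} in F].

(* Main.v *)
Require Import Defs.
From HB Require Import structures.
From mathcomp Require Import all_boot all_order all_algebra all_fingroup.
From mathcomp Require Import polyrcf reals.
From mathcomp Require Import zify.
Import Order.TTheory GRing.Theory Num.Theory.
Local Open Scope ring_scope.

(** Hong's bound turns [rho(G_i) > n-2] into: every [G_i] misses at most [n-2]
    pairs.  Let [w(x,y)] be the number of [i] with [xy] missing from [G_i].
    Averaging over all cyclic orders gives a Hamiltonian cycle of total weight
    less than [2(n-1)]; on such a cycle the edges can be assigned to distinct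
    graphs unless some edge has weight [n].  In that case put this edge between
    [v_0] and [v_{n-1}] and consider the [n-3] cycles obtained by replacing it and
    [v_a v_{a+1}] by [v_a v_{n-1}] and [v_{a+1} v_0]: if none of them is rainbow,
    each new pair of edges has weight at least [n], and as the total weight is at
    most [n(n-2)] everything is tight.  So all [G_i] are equal, and the missing
    edges form a double star with [n-2] edges centred at [v_0] and [v_{n-1}].  A
    star gives the pendant clique, a triangle ([n = 5]) has a complement of
    spectral radius exactly [3], and in all other cases the complement has a
    Hamiltonian cycle through which both centres are routed explicitly. *)

(** * Systems of distinct representatives and averaging over permutations *)

Lemma perm_map2 (T : finType) (a b c d : T) :
  a != b -> c != d -> exists p : {perm T}, p a = c /\ p b = d.
Proof.
move=> ab cd; exists (tperm a c * tperm (tperm a c b) d)%g.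
rewrite !permM tpermL; split; last by rewrite tpermL.
rewrite tpermD //; last by rewrite eq_sym.
by rewrite -{2}(tpermL a c) (inj_eq perm_inj) eq_sym.
Qed.

Lemma perm_avoiding (T : finType) (b : T -> T -> bool) :
  (\sum_k \sum_l b k l < 2 * #|T|.-1)%N ->
  (forall k, exists l, ~~ b k l) -> (forall l, exists k, ~~ b k l) ->
  exists s : {perm T}, forall k, ~~ b k (s k).
Proof.
(* Take s with the fewest bad positions and suppose k is one.  With L the rows good
   for s k and M the positions m with s m good for k, a 3-cycle through k, l, m shows
   that (m, s l) is bad on M x L, which already makes 2(n-1) + (|L|-1)(|M|-1) bad entries. *)
move=> small rowP colP.
pose c (s : {perm T}) := (\sum_k b k (s k))%N.
case: (arg_minnP c (erefl : predT 1%g)) => s _ smin.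
have [/existsP[k bk]|/existsPn] := boolP [exists k, b k (s k)]; last by exists s.
pose L := [set l | ~~ b l (s k)]; pose M := [set m | ~~ b k (s m)].
have kL : k \notin L by rewrite inE bk.
have kM : k \notin M by rewrite inE bk.
have LM l m : l \in L -> m \in M -> (l != m) && b m (s l).
  rewrite !inE => lL mM; apply/negPn/negP; rewrite negb_and negbK => lm.
  have kl : k != l by apply: contraNneq lL => <-.
  have km : k != m by apply: contraNneq mM => <-.
  (* [t * s] gives [k] the image [s m], [l] the image [s k] and [m] the image [s l], all good. For
     [l = m] it degenerates to swapping the images of [k] and [l]. Other positions keep their
     images, so the count drops. *)
  pose t := (tperm k l * tperm l m)%g.
  suff: (c (t * s)%g < c s)%N by rewrite ltnNge smin.
  rewrite /c (bigD1 k) //= [X in (_ < X)%N](bigD1 k) //= bk.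
  rewrite permM {1}/t permM tpermL tpermL (negbTE mM) add0n ltnS.
  apply: leq_sum => x xk; rewrite permM {1}/t permM.
  have [->|xl] := eqVneq x l.
    rewrite tpermR tpermD 1?eq_sym // (negbTE lL) //.
  rewrite [tperm k l x]tpermD 1?[_ == x]eq_sym //.
  have [xm|xm] := eqVneq x m; last by rewrite tpermD 1?[_ == x]eq_sym.
  move: lm; rewrite xm tpermR -xm eq_sym (negbTE xl) /= => /negbTE -> //.
have [l0 l0L] : exists l, l \in L by have [l] := colP (s k); exists l; rewrite inE.
have [m0 m0M] : exists m, m \in M.
  by have [m] := rowP k; exists ((s^-1)%g m); rewrite inE permKV.
have rowE x : (\sum_l b x l = \sum_l b x (s l))%N by rewrite (reindex_inj (@perm_inj _ s)).
have cardS (A : {set T}) : (\sum_x (x \in A) = #|A|)%N.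
  by rewrite -sum1_card [RHS]big_mkcond; apply: eq_bigr => x _; case: (x \in A).
have cardC (A : {set T}) : (\sum_x (x \notin A) = #|T| - #|A|)%N.
  rewrite -(cardsC A) -!cardS addKn.
  by apply: eq_bigr => x _; rewrite inE.
(* Outside [L] a row is bad in column [s k]; a row of [M] is also bad in the [#|L|] columns [s l];
   row [k] has [#|T| - #|M|] bad entries in all, one of them counted by the last term. Summing over
   [x] gives [2(n-1) + (|L|-1)(|M|-1)] with [n = #|T|]. *)
have row x : ((x \in M) * #|L| + (x == k) * (#|T| - #|M|.+1) + (x \notin L)
              <= \sum_l b x l)%N.
  rewrite rowE; have [->|xk] := eqVneq x k.
    rewrite (negbTE kM) kL mul0n mul1n add0n.
    have -> : (\sum_l b k (s l) = #|T| - #|M|)%N.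
      by rewrite -cardC; apply: eq_bigr => l _; rewrite inE negbK.
    have : (#|M| < #|T|)%N.
      rewrite -cardsT; apply: proper_card; apply/properP; split=> //.
      by exists k.
    lia.
  rewrite mul0n addn0; have [xM|xM] := boolP (x \in M).
    rewrite mul1n (bigD1 k) //= addnC leq_add //; first by rewrite inE negbK.
    rewrite -cardS (bigD1 k) //= (negbTE kL) add0n.
    apply: leq_sum => l _; case: (boolP (l \in L)) => // lL.
    by have /andP[_ ->] := LM _ _ lL xM.
  by rewrite mul0n add0n (bigD1 k) //= inE negbK leq_addr.
move: small; rewrite ltnNge => /negP[].
apply: leq_trans (leq_sum _ (fun x _ => row x)).
rewrite !big_split -!big_distrl /= cardS cardC.
have -> : (\sum_x (x == k) = 1)%N.
  by rewrite (bigD1 k) //= eqxx big1 // => x /negbTE->.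
have : (#|L :|: M| < #|T|)%N.
  rewrite -cardsT; apply: proper_card; apply/properP; split=> //.
  by exists k => //; rewrite in_setU negb_or kL.
rewrite cardsU disjoint_setI0 ?cards0 ?subn0; last first.
  apply/pred0P => x; apply/negbTE/negP => /andP[xL xM].
  by have /andP[/eqP] := LM _ _ xL xM.
have : (0 < #|L|)%N by apply/card_gt0P; exists l0.
have : (0 < #|M|)%N by apply/card_gt0P; exists m0.
move: #|L| #|M| #|T| => l m t; nia.
Qed.

(** Summed over all [v], the term [f (v k) (v l)] is the same for every [l != k], by relabelling.
    Hence [#|T|.-1] copies of the term at [sg k] amount to the whole row of [k], and the two sides
    have equal averages over [v]. *)
Lemma cyclic_averaging (T : finType) (sg : T -> T) (f : T -> T -> nat) :
  (forall k, sg k != k) -> (forall x, f x x = 0)%N ->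
  exists v : {perm T},
    (#|T|.-1 * \sum_k f (v k) (v (sg k)) <= \sum_x \sum_y f x y)%N.
Proof.
move=> sgk f0; set t := (\sum_x \sum_y f x y)%N.
pose S k l := (\sum_(v : {perm T}) f (v k) (v l))%N.
have SE k l l' : k != l -> k != l' -> S k l = S k l'.
  move=> kl kl'; have [p [pk pl]] := perm_map2 _ _ _ _ _ kl kl'.
  rewrite /S (reindex_inj (mulgI p)); apply: eq_bigr => v _.
  by rewrite !permM pk pl.
have tE (v : {perm T}) : (\sum_k \sum_l f (v k) (v l) = t)%N.
  rewrite /t [RHS](reindex_inj (@perm_inj _ v)); apply: eq_bigr => k _.
  by rewrite [RHS](reindex_inj (@perm_inj _ v)).
have total : (\sum_(v : {perm T}) #|T|.-1 * \sum_k f (v k) (v (sg k))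
              = \sum_(v : {perm T}) t)%N.
  rewrite -big_distrr exchange_big /= big_distrr /=.
  under [RHS]eq_bigr => v _ do rewrite -(tE v).
  rewrite [RHS]exchange_big /=; apply: eq_bigr => k _.
  rewrite [RHS]exchange_big /= (bigD1 k) //=.
  rewrite [X in (X + _)%N]big1 ?add0n; last by move=> v _; rewrite f0.
  rewrite -/(S k (sg k)) [RHS](eq_bigr (fun=> S k (sg k))); last first.
    by move=> l lk; apply: SE; rewrite eq_sym.
  rewrite sum_nat_const; congr (_ * _)%N.
  by rewrite -(cardC1 k); apply: eq_card => x; rewrite !inE.
apply/existsP; apply: contraT => /existsPn all.
have : (\sum_(v : {perm T}) t < \sum_(v : {perm T}) #|T|.-1 * \sum_k f (v k) (v (sg k)))%N.
  rewrite (bigD1 1%g) //= [X in (_ < X)%N](bigD1 1%g) //= -addSn.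
  apply: leq_add; first by rewrite ltnNge.
  by apply: leq_sum => v _; apply: ltnW; rewrite ltnNge.
by rewrite total ltnn.
Qed.

(** * Two-switches of a cycle *)

Definition cyclic_sum (T : Type) (w : T -> T -> nat) (m : nat) (g : nat -> T) : nat :=
  (\sum_(0 <= j < m) w (g j) (g j.+1) + w (g m) (g 0))%N.

(** The tail after [a] is run backwards: [j] becomes [m.+1 + a - j], which exchanges [a.+1] and
    [m]. *)
Definition two_switch (T : Type) (m a : nat) (g : nat -> T) (j : nat) : T :=
  if (j <= a)%N then g j else g (m.+1 + a - j)%N.

(** Symmetry of [w] preserves the total of the reversed tail, so only the step at [a] and the
    closing pair change. Removed pairs are added on the left to avoid truncated subtraction. *)
Lemma cyclic_sum_two_switch (T : Type) (w : T -> T -> nat) (m a : nat) (g : nat -> T) :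
  (forall x y, w x y = w y x) -> (a < m)%N ->
  (cyclic_sum _ w m (two_switch _ m a g) + (w (g a) (g a.+1) + w (g m) (g 0))
   = cyclic_sum _ w m g + (w (g a) (g m) + w (g a.+1) (g 0)))%N.
Proof.
move=> wC am; rewrite /cyclic_sum.
have split h : (\sum_(0 <= j < m) h j = \sum_(0 <= j < a) h j + h a + \sum_(a.+1 <= j < m) h j)%N.
  by rewrite (big_cat_nat _ (n := a.+1)) // big_nat_recr.
rewrite !split /two_switch leqnn ltnn leq0n leqNgt am /=.
rewrite (eq_big_nat _ _ (F2 := fun j => w (g j) (g j.+1))); last first.
  by move=> j /andP[_ ja]; rewrite ltnW // ja.
rewrite [X in (_ + _ + X + _ + _)%N](_ : _ = \sum_(a.+1 <= j < m) w (g j) (g j.+1))%N; last first.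
  rewrite [RHS]big_nat_rev; apply: eq_big_nat => j /andP[aj jm].
  rewrite leqNgt aj /= leqNgt ltnS (ltnW aj) /= wC; congr (w (g _) (g _)); lia.
have -> : (m.+1 + a - a.+1 = m)%N by lia.
have -> : (m.+1 + a - m = a.+1)%N by lia.
lia.
Qed.

Lemma two_switch_perm (m a : nat) (v : {perm 'I_m.+1}) : (a < m)%N ->
  exists v' : {perm 'I_m.+1}, forall j, (j <= m)%N ->
    v' (inord j) = two_switch _ m a (fun j => v (inord j)) j.
Proof.
move=> am; pose r (k : 'I_m.+1) : 'I_m.+1 := if (k <= a)%N then k else inord (m.+1 + a - k)%N.
have rK : involutive r.
  move=> k; rewrite /r; have [->//|ak] := leqP k a.
  have km := ltn_ord k.
  by rewrite inordK; [case: ifP; [lia|move=> _; apply/val_inj; rewrite /= inordK; lia]|lia].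
exists (perm (inv_inj rK) * v)%g => j jm; rewrite permM permE /r /two_switch inordK //.
by case: ifP.
Qed.

Lemma sum_ordS_cyclic_sum (m : nat) (v : 'I_m.+1 -> 'I_m.+1) (w : 'I_m.+1 -> 'I_m.+1 -> nat) :
  (\sum_k w (v k) (v (ordS k)) = cyclic_sum _ w m (fun j => v (inord j)))%N.
Proof.
rewrite big_ord_recr /cyclic_sum big_mkord; congr (_ + w (v _) (v _))%N.
- apply: eq_bigr => k _; congr (w (v _) (v _)); apply/val_inj => /=.
    by rewrite inordK // ltnW // ltnS ltn_ord.
  by rewrite modn_small ?inordK // !ltnS ltn_ord.
- by apply/val_inj; rewrite /= inordK.
- by apply/val_inj; rewrite /= inordK // modnn.
Qed.

Lemma ordS_neq (m : nat) (k : 'I_m.+2) : ordS k != k.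
Proof.
apply/eqP => /(congr1 val) /=; have := ltn_ord k; rewrite ltnS leq_eqVlt.
case/predU1P => [->|km]; first by rewrite modnn.
rewrite modn_small //; lia.
Qed.

Lemma ordS2_neq (m : nat) (k : 'I_m.+3) : ordS (ordS k) != k.
Proof.
apply/eqP => /(congr1 val) /=; rewrite -(addn1 (_ %% _)) modnDml addn1.
have := ltn_ord k; rewrite ltnS leq_eqVlt => /predU1P[->|].
  by rewrite -(addn1 m.+3) modnDl.
rewrite ltnS leq_eqVlt => /predU1P[->|km]; first by rewrite modnn.
rewrite modn_small; lia.
Qed.

Lemma iter_ordS_val (m j : nat) (k : 'I_m.+1) : val (iter j (@ordS _) k) = ((k + j) %% m.+1)%N.
Proof.
elim: j => [|j IH] /=; first by rewrite addn0 modn_small.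
by rewrite [nat_of_ord _]IH -(addn1 (_ %% _)) modnDml addn1 addnS.
Qed.

Lemma leq_sum_nat_term (m j : nat) (F : nat -> nat) :
  (j < m)%N -> (F j <= \sum_(0 <= i < m) F i)%N.
Proof. by move=> jm; rewrite big_mkord (bigD1 (Ordinal jm)) //= leq_addr. Qed.

(* The pairs of [0..m] are the closing pair, the two extreme path steps, the pairs
   used by the m-2 possible two-switches, and the inner pairs. *)
Lemma sum_pairs_split (m : nat) (Z : nat -> nat -> nat) : (2 <= m)%N ->
  (\sum_(0 <= b < m.+1) \sum_(0 <= a < b) Z a b =
   Z 0 m + Z 0 1 + Z m.-1 m + \sum_(1 <= a < m.-1) (Z a m + Z 0 a.+1)
   + \sum_(1 <= b < m) \sum_(1 <= a < b) Z a b)%N.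
Proof.
case: m => [|[|m]] // _; rewrite big_nat_recr //= [X in (X + _)%N]big_nat_recl //.
rewrite [X in (X + _ + _)%N]big_geq // add0n.
have -> : (\sum_(0 <= i < m.+1) \sum_(0 <= a < i.+1) Z a i.+1
   = \sum_(0 <= i < m.+1) Z 0 i.+1 + \sum_(1 <= b < m.+2) \sum_(1 <= a < b) Z a b)%N.
  rewrite (big_add1 _ _ _ m.+2) -big_split /=; apply: eq_bigr => i _.
  by rewrite big_nat_recl // big_add1.
rewrite [in RHS]big_split /= !(big_add1 _ _ _ m.+1) /=.
rewrite [X in (X + _ + _)%N]big_nat_recl //.
rewrite [X in (_ + X)%N]big_nat_recl // [X in (_ + (_ + X))%N]big_nat_recr //=.
lia.
Qed.

(** * The double star *)

(** [B i] is meant as the relation of pairs missing from the [i]-th graph; graphs and vertices share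
    the index type [T], being equally many. *)
Definition weight (T : finType) (B : T -> rel T) (x y : T) : nat := (\sum_i B i x y)%N.

Lemma weight_sym (T : finType) (B : T -> rel T) :
  (forall i, symmetric (B i)) -> forall x y, weight _ B x y = weight _ B y x.
Proof. by move=> BC x y; apply: eq_bigr => i _; rewrite BC. Qed.

Lemma weight_le (T : finType) (B : T -> rel T) x y : (weight _ B x y <= #|T|)%N.
Proof. by rewrite -sum1_card; apply: leq_sum => i _; case: (B i x y). Qed.

Lemma weight_eq0 (T : finType) (B : T -> rel T) x y :
  weight _ B x y = 0%N -> forall i, B i x y = false.
Proof.
by move=> /eqP; rewrite sum_nat_eq0 => /forallP h i; have := h i; case: (B i x y).
Qed.

Lemma weight_full (T : finType) (B : T -> rel T) x y :
  weight _ B x y = #|T| -> forall i, B i x y.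
Proof.
move=> h i; apply: contraT => Bi; suff: (weight _ B x y < #|T|)%N by rewrite h ltnn.
rewrite /weight -sum1_card (bigD1 i) //= [X in (_ < X)%N](bigD1 i) //= (negbTE Bi) add0n add1n ltnS.
by apply: leq_sum => j _; case: (B j x y).
Qed.

Lemma sum_sym_ord (n : nat) (f : 'I_n -> 'I_n -> nat) :
  (forall x y, f x y = f y x) -> (forall x, f x x = 0)%N ->
  (\sum_x \sum_y f x y = 2 * \sum_(y < n) \sum_(x < n | x < y) f x y)%N.
Proof.
move=> fC f0; rewrite mul2n -addnn.
have -> : (\sum_x \sum_y f x y =
   \sum_(x < n) (\sum_(y < n | y < x) f x y + \sum_(y < n | x < y) f x y))%N.
  apply: eq_bigr => x _; rewrite (bigD1 x) //= f0 add0n.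
  rewrite (bigID (fun y : 'I_n => y < x)%N) /=.
  congr (_ + _)%N; apply: eq_bigl => y; rewrite -(inj_eq val_inj) /=; lia.
rewrite big_split /=; congr (_ + _)%N.
  by apply: eq_bigr => x _; apply: eq_bigr => y _; apply: fC.
by rewrite (exchange_big_dep xpredT).
Qed.

Lemma sum_pairs_inord (m : nat) (f : 'I_m.+1 -> 'I_m.+1 -> nat) :
  (\sum_(y < m.+1) \sum_(x < m.+1 | x < y) f x y =
   \sum_(0 <= b < m.+1) \sum_(0 <= a < b) f (inord a) (inord b))%N.
Proof.
rewrite [RHS]big_mkord; apply: eq_bigr => y _; rewrite inord_val.
rewrite (big_nat_widen _ _ m.+1); last exact: ltnW.
by rewrite big_mkord; apply: eq_bigr => x _; rewrite inord_val.
Qed.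

(** This is [perm_avoiding] for cycle edges against graphs. No edge is missing from all graphs, and
    a graph missing all cycle edges would have two distinct missing neighbours at each vertex, hence
    [2n] ordered missing pairs. *)
Lemma rainbow_of_light_cycle (m : nat) (B : 'I_m.+3 -> rel 'I_m.+3) (v : {perm 'I_m.+3}) :
  (forall i, symmetric (B i)) ->
  (forall i, \sum_x \sum_y B i x y < 2 * m.+3)%N ->
  (\sum_k weight _ B (v k) (v (ordS k)) < 2 * m.+2)%N ->
  (forall k, weight _ B (v k) (v (ordS k)) < m.+3)%N ->
  exists s : {perm 'I_m.+3}, forall k, ~~ B (s k) (v k) (v (ordS k)).
Proof.
move=> BC Bsmall small notfull.
apply: (perm_avoiding _ (fun k i => B i (v k) (v (ordS k)))).
- by rewrite card_ord.
- move=> k; apply/existsP; apply: contraT => /existsPn all.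
  have := notfull k; rewrite /weight (eq_bigr (fun=> 1%N)) ?sum1_card ?card_ord ?ltnn //.
  by move=> i _; have := all i; rewrite negbK => ->.
- move=> i; apply/existsP; apply: contraT => /existsPn all.
  have := Bsmall i; rewrite ltnNge => /negP[].
  rewrite (reindex_inj (@perm_inj _ v)) (reindex_inj (@ordS_inj _)) /=.
  rewrite mulnC -[X in (X * 2)%N](card_ord m.+3) -sum_nat_const; apply: leq_sum => k _.
  have bk l : B i (v l) (v (ordS l)) by have := all l; rewrite negbK.
  rewrite (reindex_inj (@perm_inj _ v)) (bigD1 k) //= (bigD1 (ordS (ordS k))) ?ordS2_neq //= bk BC bk.
  by rewrite add1n addSn ltnS.
Qed.

Lemma double_star_of_no_rainbow (m : nat) (B : 'I_m.+4 -> rel 'I_m.+4) :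
  (forall i, symmetric (B i)) -> (forall i x, B i x x = false) ->
  (forall i, \sum_x \sum_y B i x y <= 2 * m.+2)%N ->
  ~ (exists v s : {perm 'I_m.+4}, forall k, ~~ B (s k) (v k) (v (ordS k))) ->
  exists v : {perm 'I_m.+4},
    let Z a b := weight _ B (v (inord a)) (v (inord b)) in
    [/\ Z 0 m.+3 = m.+4, Z 0 1 = 0 /\ Z m.+2 m.+3 = 0,
      forall a, 1 <= a < m.+2 ->
        (Z a m.+3 = m.+4 /\ Z 0 a.+1 = 0) \/ (Z a m.+3 = 0 /\ Z 0 a.+1 = m.+4)
    & forall a b, 1 <= a < b -> b < m.+3 -> Z a b = 0]%N.
Proof.
move=> BC B0 Bsmall norb; set w := weight _ B.
have wC : forall x y, w x y = w y x by exact: weight_sym.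
have w0 x : w x x = 0%N by rewrite /w /weight big1 // => i _; rewrite B0.
have wle x y : (w x y <= m.+4)%N by rewrite -[m.+4]card_ord weight_le.
have total : (\sum_x \sum_y w x y <= m.+4 * (2 * m.+2))%N.
  rewrite -[X in (X * _)%N](card_ord m.+4) -sum_nat_const.
  rewrite [X in (X <= _)%N](_ : _ = \sum_i \sum_x \sum_y B i x y)%N; last first.
    by rewrite [RHS]exchange_big; apply: eq_bigr => x _; rewrite [RHS]exchange_big.
  by apply: leq_sum.
have heavy (v : {perm 'I_m.+4}) : (forall k, w (v k) (v (ordS k)) < m.+4)%N ->
    (2 * m.+3 <= \sum_k w (v k) (v (ordS k)))%N.
  move=> lt; rewrite leqNgt; apply/negP => small; apply: norb; exists v.
  apply: (rainbow_of_light_cycle m.+1) => // i; have := Bsmall i; lia.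
have [v0 light0] := cyclic_averaging _ _ _ (@ordS_neq _) w0.
rewrite card_ord /= in light0.
(* With [n = m.+4] and [W] the weight of the cycle, [(n-1) W <= 2n(n-2) < 2(n-1)^2]. *)
have {}light0 : (\sum_k w (v0 k) (v0 (ordS k)) < 2 * m.+3)%N.
  by move: (leq_trans light0 total); move: (\sum_k _)%N => W; nia.
have /existsP[k0 full0] : [exists k, w (v0 k) (v0 (ordS k)) == m.+4].
  apply: contraT => /existsPn nf; move: light0; rewrite ltnNge heavy // => k.
  by rewrite ltn_neqAle nf wle.
(* Rotating by [k0.+1] makes the full edge the closing one, from the last position to position 0. *)
pose v := (perm (@ordS_inj m.+4) ^+ k0.+1 * v0)%g.
have vE k : v k = v0 (iter k0.+1 (@ordS _) k).
  by rewrite permM permX; congr (v0 _); apply: eq_iter => x; rewrite permE.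
have iterk0 : iter k0.+1 (@ordS _) (@ord_max m.+3) = k0.
  by apply/val_inj; rewrite iter_ordS_val /= addnS -addSn modnDl modn_small.
have light : (\sum_k w (v k) (v (ordS k)) < 2 * m.+3)%N.
  apply: leq_ltn_trans light0; rewrite [X in (_ <= X)%N](reindex_inj (@perm_inj _ (perm (@ordS_inj m.+4) ^+ k0.+1)%g)) /=.
  apply: leq_sum => k _; rewrite !permM; apply: eq_leq; congr (w _ (v0 _)).
  by rewrite !permX !(eq_iter (fun x => permE _ x)) -iterSr.
rewrite sum_ordS_cyclic_sum in light.
exists v => Z; pose U j := v (inord j).
rewrite -/U in light.
have Zm0 : w (U m.+3) (U 0) = m.+4.
  rewrite /U (_ : inord m.+3 = ord_max); last by apply/val_inj; rewrite /= inordK.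
  rewrite (_ : inord 0 = ordS ord_max); last by apply/val_inj; rewrite /= inordK // modnn.
  by rewrite !vE iterk0 -(iterSr k0.+1) iterS iterk0; apply/eqP.
have Z0m : Z 0 m.+3 = m.+4 by rewrite /Z -/w wC.
pose p := (\sum_(0 <= j < m.+3) w (U j) (U j.+1))%N.
have p_small : (p + m.+4 < 2 * m.+3)%N by rewrite -Zm0.
(* The path steps weigh [p <= n-3] together, so no surviving edge is full. If neither new edge is
   full, [heavy] forces the switched cycle up to [2(n-1)], so the new edges weigh more than [n]. For
   [a = 0] or [a = m.+2] the switch would leave the cycle unchanged. *)
have switched a : (1 <= a < m.+2)%N ->
  [\/ Z a m.+3 = m.+4, Z 0 a.+1 = m.+4 | m.+4 < Z a m.+3 + Z 0 a.+1]%N.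
  move=> /andP[a0 am]; have am' : (a < m.+3)%N by lia.
  have [v' v'E] := two_switch_perm m.+3 a v am'.
  have sumv' : (\sum_k w (v' k) (v' (ordS k)) =
      cyclic_sum _ w m.+3 (two_switch _ m.+3 a U))%N.
    rewrite sum_ordS_cyclic_sum /cyclic_sum !v'E //; congr (_ + _)%N.
    by apply: eq_big_nat => j jm; rewrite !v'E //; lia.
  have := cyclic_sum_two_switch _ w m.+3 a U wC am'.
  rewrite -sumv' /cyclic_sum -/p Zm0 => switchE.
  rewrite /Z -/w -!/(U _) (wC (U 0)).
  have [/eqP|q1] := boolP (w (U a) (U m.+3) == m.+4); first by constructor 1.
  have [/eqP|q2] := boolP (w (U a.+1) (U 0) == m.+4); first by constructor 2.
  constructor 3; suff: (2 * m.+3 <= \sum_k w (v' k) (v' (ordS k)))%N.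
    move: switchE p_small; move: (w _ _) (w _ _) (w _ _) p (\sum_k _)%N; lia.
  apply: heavy => k.
  have edge j : (j < m.+3)%N -> (w (U j) (U j.+1) < m.+4)%N.
    move=> jm; have : (w (U j) (U j.+1) <= p)%N.
      exact: (leq_sum_nat_term _ _ (fun j => w (U j) (U j.+1)) jm).
    by lia.
  have [km|] := ltnP k m.+3.
    have -> : k = inord k by rewrite inord_val.
    have -> : ordS (inord k) = inord k.+1 :> 'I_m.+4.
      by apply/val_inj; rewrite /= !inordK ?modn_small //; lia.
    rewrite !v'E; try lia; rewrite /two_switch.
    have [ka|ka|->] := ltngtP k a.
    - by apply: edge; lia.
    - rewrite wC.
      have -> : (m.+4 + a - k = (m.+4 + a - k.+1).+1)%N by lia.
      by apply: edge; lia.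
    - have -> : (m.+4 + a - a.+1 = m.+3)%N by lia.
      by rewrite ltn_neqAle q1 wle.
  move=> mk; have -> : k = inord m.+3 by apply/val_inj; rewrite /= inordK //; have := ltn_ord k; lia.
  have -> : ordS (inord m.+3) = inord 0 :> 'I_m.+4.
    by apply/val_inj; rewrite /= !inordK // modnn.
  rewrite !v'E // /two_switch leq0n (leqNgt m.+3) am' /=.
  have -> : (m.+4 + a - m.+3 = a.+1)%N by lia.
  by rewrite ltn_neqAle q2 wle.
have totalZ : (\sum_(0 <= b < m.+4) \sum_(0 <= a < b) Z a b <= m.+4 * m.+2)%N.
  by rewrite -(sum_pairs_inord _ (fun x y => w (v x) (v y))); move: total;
    rewrite (reindex_inj (@perm_inj _ v)) /=;
    under eq_bigr do rewrite (reindex_inj (@perm_inj _ v)) /=;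
    rewrite sum_sym_ord // mulnCA leq_pmul2l.
rewrite sum_pairs_split // Z0m in totalZ.
have sw_ge : (\sum_(1 <= a < m.+2) m.+4 <= \sum_(1 <= a < m.+2) (Z a m.+3 + Z 0 a.+1))%N.
  rewrite !big_nat; apply: leq_sum => a /switched[->|->|/ltnW//]; [exact: leq_addr|exact: leq_addl].
have sumc : (\sum_(1 <= a < m.+2) m.+4 = m.+4 * m.+1)%N.
  by rewrite sum_nat_const_nat subn1 mulnC.
rewrite /= in totalZ.
(* The closing pair takes [n] and the [n-3] switches at least [n] each, which exhausts the total
   [n(n-2)]. *)
have [sw_eq Z01 Zm inner] : [/\ \sum_(1 <= a < m.+2) (Z a m.+3 + Z 0 a.+1) = m.+4 * m.+1,
    Z 0 1 = 0, Z m.+2 m.+3 = 0 & \sum_(1 <= b < m.+3) \sum_(1 <= a < b) Z a b = 0]%N.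
  move: totalZ sw_ge; rewrite sumc.
  move: (\sum_(1 <= a < m.+2) _)%N (\sum_(1 <= b < m.+3) _)%N (Z 0 1)%N (Z m.+2 m.+3) => x y z t.
  by move=> le_total ge_sw; split; nia.
have sw_tight a : (1 <= a < m.+2)%N -> (Z a m.+3 + Z 0 a.+1 = m.+4)%N.
  move=> a1m; have am : (a - 1 < m.+1)%N by lia.
  pose F i := (Z i.+1 m.+3 + Z 0 i.+2)%N.
  have F_ge i : (i < m.+1)%N -> (m.+4 <= F i)%N.
    by move=> im; rewrite /F; case: (switched i.+1 im) => [->|->|/ltnW//];
      [exact: leq_addr|exact: leq_addl].
  move: sw_eq; rewrite big_add1 /= -/(F _) big_mkord (bigD1 (Ordinal am)) //=.
  have : (m.+4 * m <= \sum_(i < m.+1 | i != Ordinal am) F i)%N.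
    rewrite mulnC -[X in (X * _)%N](_ : #|predC1 (Ordinal am)| = m)%N; last first.
      by rewrite cardC1 card_ord.
    by rewrite -sum_nat_const; apply: leq_sum => i _; apply: F_ge.
  have := F_ge _ am; rewrite /F (_ : (a - 1).+1 = a); last lia.
  move: (\sum_(_ < _ | _) _)%N (Z a m.+3) (Z 0 a.+1)%N => x y z; nia.
split=> // [a a1m|a b /andP[a1 ab] bm].
  have := sw_tight a a1m; case: (switched a a1m) => [->|->|].
  - by move=> h; left; split=> //; lia.
  - by move=> h; right; split=> //; lia.
  - by move=> h1 h2; rewrite h2 ltnn in h1.
apply/eqP; rewrite -leqn0 -inner.
apply: leq_trans (_ : \sum_(1 <= a < b) Z a b <= _)%N.
  rewrite big_add1 (_ : a = (a - 1).+1); last lia.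
  by apply: (leq_sum_nat_term _ _ (fun a => Z a.+1 b)); lia.
rewrite (big_add1 _ _ _ m.+3) (_ : b = (b - 1).+1); last lia.
by apply: (leq_sum_nat_term _ _ (fun b => \sum_(1 <= a < b.+1) Z a b.+1)%N); lia.
Qed.

(** * Hamiltonian cycles avoiding a double star *)

Lemma perm_with_prefix (m : nat) (x : 'I_m.+1) (s : seq 'I_m.+1) : uniq s ->
  (size s <= m.+1)%N /\ exists v : {perm 'I_m.+1},
    forall k, (k < size s)%N -> v (inord k) = nth x s k.
Proof.
move=> us; pose t := s ++ [seq y <- enum 'I_m.+1 | y \notin s].
have ut : uniq t.
  rewrite cat_uniq us filter_uniq ?enum_uniq // andbT /=.
  by apply/hasPn => y; rewrite mem_filter => /andP[].
have st : size t = m.+1.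
  rewrite -[RHS](size_enum_ord m.+1); apply: perm_size; apply: uniq_perm; rewrite ?enum_uniq //.
  by move=> y; rewrite mem_enum mem_cat mem_filter mem_enum; case: (y \in s).
have inj : injective (fun k : 'I_m.+1 => nth x t k).
  by move=> i j /eqP; rewrite nth_uniq ?st // => /eqP/val_inj.
split; first by rewrite -[X in (_ <= X)%N]st size_cat leq_addr.
exists (perm inj) => k ks; rewrite permE inordK; first by rewrite nth_cat ks.
by rewrite (leq_trans ks) // -[X in (_ <= X)%N]st size_cat leq_addr.
Qed.

Lemma ordS_inord (m k : nat) : (k < m)%N -> ordS (inord k) = inord k.+1 :> 'I_m.+1.
Proof. by move=> km; apply/val_inj; rewrite /= !inordK ?modn_small //; lia. Qed.

Ltac neq_split :=
  repeat match goal with H : is_true (_ && _) |- _ => case/andP: H => ? ? end;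
  repeat (apply/andP; split); by [|rewrite eq_sym].

(** Every pair of [D] meets [x] or [y], so only the cycle edges at these two vertices matter. The
    cycle starts with [a1 x a2 b2 y b1], or with [a1 x a2 y b1] when [a2 = b2], the only coincidence
    allowed; the other vertices follow in any order. *)
Lemma ham_cycle_double_star (m : nat) (D : rel 'I_m.+1) (x y a1 a2 b1 b2 : 'I_m.+1) :
  symmetric D -> (forall s t, D s t -> (s \in [:: x; y]) || (t \in [:: x; y])) ->
  uniq [:: x; y; a1; a2] -> uniq [:: x; y; b1; b2] ->
  a1 \notin [:: b1; b2] -> b1 \notin [:: a1; a2] ->
  ~~ D x a1 -> ~~ D x a2 -> ~~ D y b1 -> ~~ D y b2 ->
  exists v : {perm 'I_m.+1}, forall k, ~~ D (v k) (v (ordS k)).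
Proof.
move=> DC Dxy ua ub a1b b1a xa1 xa2 yb1 yb2.
have build (v : {perm 'I_m.+1}) q : (q.+1 < m)%N ->
    v (inord 1) = x -> v (inord q.+1) = y ->
    v (inord 0) = a1 -> v (inord 2) = a2 -> ~~ D y (v (inord q)) -> v (inord q.+2) = b1 ->
    forall k, ~~ D (v k) (v (ordS k)).
  move=> qm v1 vq v0 v2 yq vb k; apply/negP => Dk.
  have back p : (p < m)%N -> v (ordS k) = v (inord p.+1) -> v k = v (inord p).
    by move=> pm /perm_inj; rewrite -ordS_inord // => /ordS_inj->.
  have forw p : (p < m)%N -> v k = v (inord p) -> v (ordS k) = v (inord p.+1).
    by move=> pm /perm_inj->; rewrite ordS_inord.
  have := Dxy _ _ Dk; rewrite !inE => /orP[/orP[]|/orP[]] /eqP E.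
  - have F := forw 1%N; move: Dk; rewrite F ?v1 ?v2 ?E ?(negbTE xa2) //; lia.
  - have F := forw q.+1; move: Dk; rewrite F ?vq ?vb ?E ?(negbTE yb1) //; lia.
  - have F : v k = a1 by rewrite (back 0%N) ?v1 //; lia.
    by move: Dk; rewrite F E DC (negbTE xa1).
  - have F : v k = v (inord q) by apply: back; rewrite ?vq //; lia.
    by move: Dk; rewrite F E DC (negbTE yq).
move: ua ub a1b b1a; rewrite /= !inE !negb_or => ua ub a1b b1a.
have [ab|ab] := eqVneq a2 b2.
  have us : uniq [:: a1; x; a2; y; b1] by rewrite /= !inE !negb_or; neq_split.
  have [sz [v vE]] := perm_with_prefix _ x _ us.
  by exists v; apply: (build v 2%N); rewrite ?vE //= ab.
have us : uniq [:: a1; x; a2; b2; y; b1] by rewrite /= !inE !negb_or; neq_split.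
have [sz [v vE]] := perm_with_prefix _ x _ us.
by exists v; apply: (build v 3%N); rewrite ?vE.
Qed.

Lemma rel_eq_of_positions (m : nat) (v : {perm 'I_m.+1}) (C D : rel 'I_m.+1) :
  symmetric C -> symmetric D ->
  (forall a c, a < c -> c < m.+1 -> C (v (inord a)) (v (inord c)) = D (v (inord a)) (v (inord c)))%N ->
  forall s t, s != t -> C s t = D s t.
Proof.
move=> CC DC CD s t; rewrite -(permKV v s) -(permKV v t).
move: ((v^-1)%g s) ((v^-1)%g t) => {s t} s t; rewrite (inj_eq perm_inj) => st.
rewrite -(inord_val s) -(inord_val t).
have [sl|tl|/val_inj e] := ltngtP s t; last by rewrite e eqxx in st.
- exact: CD.
- by rewrite CC DC; apply: CD.
Qed.

Lemma rainbow_dichotomy (m : nat) (B : 'I_m.+4 -> rel 'I_m.+4) :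
  (forall i, symmetric (B i)) -> (forall i x, B i x x = false) ->
  (forall i, \sum_x \sum_y B i x y <= 2 * m.+2)%N ->
  [\/ exists v s : {perm 'I_m.+4}, forall k, ~~ B (s k) (v k) (v (ordS k)),
      exists2 yz : 'I_m.+4 * 'I_m.+4, yz.1 != yz.2 &
        forall i s t, s != t ->
          B i s t = (s == yz.1) && (t != yz.2) || (t == yz.1) && (s != yz.2)
    | m = 1%N /\ exists2 T : {set 'I_m.+4}, #|T| = 3%N &
        forall i s t, s != t -> B i s t = (s \in T) && (t \in T)].
Proof.
move=> BC B0 Bsmall.
have [/existsP[v /existsP[s /forallP vs]]|no] := boolP [exists v : {perm 'I_m.+4},
    exists s : {perm 'I_m.+4}, forall k, ~~ B (s k) (v k) (v (ordS k))].
  by constructor 1; exists v, s.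
have norb : ~ (exists v s : {perm 'I_m.+4}, forall k, ~~ B (s k) (v k) (v (ordS k))).
  move=> [v [s vs]]; case/negP: no; apply/existsP; exists v; apply/existsP; exists s.
  exact/forallP.
have [v] := double_star_of_no_rainbow _ _ BC B0 Bsmall norb.
set Z := fun a b => _; move=> [Z0m [Z01 Zm] alt inner].
pose U a := v (inord a).
have Zfull a c : Z a c = m.+4 -> forall i, B i (U a) (U c).
  by move=> h; apply: weight_full; rewrite card_ord.
have Z0 a c : Z a c = 0%N -> forall i, B i (U a) (U c) = false.
  by move=> h; apply: weight_eq0.
have UE a b : (a < m.+4)%N -> (b < m.+4)%N -> (U a == U b) = (a == b).
  by move=> am bm; rewrite (inj_eq perm_inj) -(inj_eq val_inj) /= !inordK.
(* If every switch puts its missing pair at [U 0], the missing pairs form a star centred there and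
   [U 1] is the only neighbour left. The mirror case at [U m.+3] comes next. Otherwise [U 0] is also
   joined to [U i0.+1], and [U m.+3] to [U j0]. *)
have [/existsP[i0 /andP[i01 Zi]]|/existsPn noi] :=
    boolP [exists i : 'I_m.+2, (0 < i)%N && (Z 0 i.+1 == 0)%N]; last first.
  constructor 2; exists (U 0, U 1%N) => [|i]; first by rewrite UE.
  apply: (rel_eq_of_positions _ v) => // [s t|a c ac cm] /=; first by rewrite orbC.
  rewrite -!/(U _) !UE //; try lia.
  have altR a' : (1 <= a' < m.+2)%N -> Z a' m.+3 = 0%N /\ Z 0 a'.+1 = m.+4.
    move=> a'm; case: (alt a' a'm) => // -[_ h].
    by have := noi (Ordinal (proj2 (andP a'm))); rewrite /= h eqxx (proj1 (andP a'm)).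
  case: a ac => [|a] ac.
    case: c ac cm => [|[|c]] // _ cm; first by rewrite Z0.
    rewrite Zfull //; case: (ltnP c.+1 m.+2) => cm2.
      by case: (altR c.+1).
    by rewrite (_ : c = m.+1) //; lia.
  rewrite Z0; first lia.
  have [cm2|cm2] := ltnP c m.+3; first by apply: inner; rewrite ?ac.
  rewrite (_ : c = m.+3); last lia.
  have [am|am] := ltnP a.+1 m.+2; first by case: (altR a.+1).
  by rewrite (_ : a = m.+1) //; lia.
have [/existsP[j0 /andP[j01 Zj]]|/existsPn noj] :=
    boolP [exists i : 'I_m.+2, (0 < i)%N && (Z i m.+3 == 0)%N]; last first.
  constructor 2; exists (U m.+3, U m.+2) => [|i]; first by rewrite UE //; lia.
  apply: (rel_eq_of_positions _ v) => // [s t|a c ac cm] /=; first by rewrite orbC.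
  rewrite -!/(U _) !UE //; try lia.
  have altL a' : (1 <= a' < m.+2)%N -> Z a' m.+3 = m.+4 /\ Z 0 a'.+1 = 0%N.
    move=> a'm; case: (alt a' a'm) => // -[h _].
    by have := noj (Ordinal (proj2 (andP a'm))); rewrite /= h eqxx (proj1 (andP a'm)).
  have [cm2|cm2] := ltnP c m.+3.
    rewrite Z0; first lia.
    case: a ac => [|a] ac; last by apply: inner; rewrite ?ac.
    case: c ac cm cm2 => [|[|c]] // _ cm cm2.
    by case: (altL c.+1).
  have -> : c = m.+3 by lia.
  have [->|am] := eqVneq a m.+2; first by rewrite Z0 //; lia.
  rewrite Zfull; first lia.
  by case: a ac am => [|a] ac am //; case: (altL a.+1); lia.
have {Zi} Zi : Z i0 m.+3 = m.+4 /\ Z 0 i0.+1 = 0%N.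
  by case: (alt i0); rewrite ?i01 ?ltn_ord // => -[_ h]; rewrite h in Zi.
have {Zj} Zj : Z j0 m.+3 = 0%N /\ Z 0 j0.+1 = m.+4.
  by case: (alt j0); rewrite ?j01 ?ltn_ord // => -[h _]; rewrite h in Zj.
have [im jm] := (ltn_ord i0, ltn_ord j0).
(* For [i = m.+1] and [j = 1] both centres would use the same two neighbours, [U 1] and [U m.+2],
   closing a 4-cycle too early; hence the last condition. *)
have build (i j : nat) : (0 < i < m.+2)%N -> (0 < j < m.+2)%N -> Z 0 i.+1 = 0%N -> Z j m.+3 = 0%N ->
    (i != m.+1) || (j != 1%N) -> False.
  move=> i12 j12 Zi0 Zj0 ij; apply: norb.
  (* Such a cycle lies in all the graphs, so any assignment works and the identity is taken. *)
  suff [v' v'P] : exists v' : {perm 'I_m.+4}, forall k, ~~ [exists i, B i (v' k) (v' (ordS k))].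
    by exists v', 1%g => k; have /existsPn := v'P k.
  pose D : rel 'I_m.+4 := fun s t => [exists i, B i s t].
  have DC : symmetric D by move=> s t; apply: eq_existsb => k; apply: BC.
  have D0 a c : Z a c = 0%N -> ~~ D (U a) (U c).
    by move=> h; apply/existsPn => k; rewrite Z0.
  have Dxy s t : D s t -> (s \in [:: U 0; U m.+3]) || (t \in [:: U 0; U m.+3]).
    have pos r : exists2 a : nat, (a < m.+4)%N & r = U a.
      by exists ((v^-1)%g r) => //; rewrite /U inord_val permKV.
    have [[a am ->] [c cm ->]] := (pos s, pos t).
    rewrite !inE !UE //; apply: contraTT => out.
    have [ac|ca|->] := ltngtP a c; last by apply/existsPn => k; rewrite B0.
    - by apply/D0/inner; lia.
    - by rewrite DC; apply/D0/inner; lia.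
  have D01 := D0 _ _ Z01; have D0i := D0 _ _ Zi0.
  have Dm := D0 _ _ Zm; have Dj := D0 _ _ Zj0; rewrite DC in Dm; rewrite DC in Dj.
  have uniqU (p q : nat) : (0 < p < m.+3)%N -> (0 < q < m.+3)%N -> p != q ->
      uniq [:: U 0; U m.+3; U p; U q].
    by move=> *; rewrite /= !inE !UE //; lia.
  have notin (p q r : nat) : (0 < p < m.+3)%N -> (0 < q < m.+3)%N -> (0 < r < m.+3)%N ->
      p != q -> p != r -> U p \notin [:: U q; U r].
    by move=> *; rewrite !inE !UE //; lia.
  have ham p q r s := ham_cycle_double_star _ D (U 0) (U m.+3) p q r s DC Dxy.
  (* The neighbours of the centres are ordered so that a common one occupies the second slot of
     both. *)
  have [j1|j1] := eqVneq j 1%N.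
    by apply: (ham (U i.+1) (U 1%N) (U m.+2) (U j)) => //; (apply: uniqU || apply: notin); lia.
  have [i1|i1] := eqVneq i.+1 m.+2.
    by apply: (ham (U 1%N) (U i.+1) (U j) (U m.+2)) => //; (apply: uniqU || apply: notin); lia.
  by apply: (ham (U 1%N) (U i.+1) (U m.+2) (U j)) => //; (apply: uniqU || apply: notin); lia.
have m1 : m = 1%N.
  have [im1|im1] := eqVneq (i0 : nat) m.+1; last first.
    by case: (build i0 j0) => //; rewrite ?i01 ?j01 ?im1 //; [case: Zi|case: Zj].
  have [jm1|jm1] := eqVneq (j0 : nat) 1%N; last first.
    by case: (build i0 j0) => //; rewrite ?i01 ?j01 ?jm1 ?orbT //; [case: Zi|case: Zj].
  have [//|m1] := eqVneq m 1%N.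
  have m0 : m != 0%N.
    by apply/eqP => m0; move: Zi Zj; rewrite im1 jm1 m0 => -[-> _] [].
  (* For [m >= 2] the switch at 2 is neither the first nor the last, so either of its outcomes
     escapes the excluded pair [i = m.+1], [j = 1]. *)
  have a2 : (0 < 2 < m.+2)%N by lia.
  case: (alt _ a2) => -[h1 h2].
    by case: (build 2%N j0) => //; lia.
  by case: (build i0 2%N) => //; lia.
constructor 3; split=> //.
have [i2 j1] : i0 = 2%N :> nat /\ j0 = 1 :> nat.
  have [i2|i2] := eqVneq (i0 : nat) 2%N; last first.
    by case: (build i0 j0) => //; lia.
  have [j1|j1] := eqVneq (j0 : nat) 1%N; last first.
    by case: (build i0 j0) => //; lia.
  by [].
rewrite i2 in Zi; rewrite j1 in Zj; rewrite m1 in Zi Zj.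
exists [set U 0; U 2%N; U 4%N].
  rewrite -[LHS](_ : #|[:: U 0; U 2%N; U 4%N]| = _)%N; last first.
    by apply: eq_card => s; rewrite !inE orbA.
  by apply/card_uniqP; rewrite /= !inE !UE //; lia.
move=> i; apply: (rel_eq_of_positions _ v) => // [s t|a c ac cm] /=; first by rewrite andbC.
rewrite -!/(U _) !inE. rewrite !UE //; try lia.
have Z04 : Z 0%N 4%N = m.+4 by move: Z0m; rewrite {1}m1.
have Z34 : Z 3%N 4%N = 0%N by move: Zm; rewrite m1.
move: Zi Zj => [Z24 Z03] [Z14 Z02].
rewrite (_ : 5 = m.+4)%N in Z24 Z02; last by rewrite m1.
have Zin : forall a b, (1 <= a < b)%N -> (b < 4)%N -> Z a b = 0%N.
  by move=> a' b' h1 h2; apply: inner => //; rewrite m1.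
have c4 : (c <= 4)%N by rewrite m1 in cm.
case: a c ac c4 {cm} => [|[|[|[|a]]]] [|[|[|[|[|c]]]]] //= _ _;
  first [by rewrite Z0 // Zin | by rewrite Zfull].
Qed.

(** * Spectral radius *)

(** Collatz-Wielandt bound: pair the entrywise absolute value of [v] with the positive weights [z].
    With [S] the resulting sum, the triangle inequality gives [mu * S <= c * S]. *)
Lemma eigenvalue_le_of_subinvariant (R : realFieldType) (n : nat) (M : 'M[R]_n)
    (z : 'I_n -> R) (c mu : R) (v : 'rV[R]_n) :
  (forall i j, 0 <= M i j) -> (forall i, 0 < z i) ->
  (forall i, \sum_j M i j * z j <= c * z i) ->
  v != 0 -> v *m M = mu *: v -> mu <= c.
Proof.
move=> M0 z0 Mz v0 vM.
pose S := \sum_j `|v 0 j| * z j.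
have S_gt0 : 0 < S.
  have [j vj] : exists j, v 0 j != 0.
    apply/existsP; apply: contraNT v0 => /existsPn all.
    by apply/eqP/rowP => j; rewrite mxE; have := all j; rewrite negbK => /eqP.
  rewrite /S (bigD1 j) //= ltr_pwDl ?mulr_gt0 ?normr_gt0 //.
  by apply: sumr_ge0 => k _; rewrite mulr_ge0 // ltW.
rewrite -(ler_pM2r S_gt0); apply: le_trans (_ : \sum_j (\sum_i `|v 0 i| * M i j) * z j <= _).
  rewrite mulr_sumr; apply: ler_sum => j _; rewrite mulrA ler_wpM2r ?(ltW (z0 j)) //.
  have := congr1 (fun u : 'rV_n => `|u 0 j|) vM; rewrite !mxE normrM => e.
  apply: le_trans (_ : `|mu| * `|v 0 j| <= _); first by rewrite ler_wpM2r ?ler_norm.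
  rewrite -e; apply: le_trans (ler_norm_sum _ _ _) _.
  by apply: ler_sum => i _; rewrite normrM (ger0_norm (M0 i j)).
under eq_bigr do rewrite mulr_suml.
rewrite exchange_big /= mulr_sumr; apply: ler_sum => i _.
under eq_bigr do rewrite -mulrA.
by rewrite -mulr_sumr mulrCA ler_wpM2l.
Qed.

(** As [0 <= c], a maximum above [c] cannot be the default 0, so it comes from a genuine root. *)
Lemma spec_rad_gt_eigenvector (R : realType) (n : nat) (E : {set {set 'I_n}}) (c : R) :
  0 <= c -> c < spec_rad R E ->
  exists mu (v : 'rV[R]_n), [/\ c < mu, v != 0 & v *m adj_mx R E = mu *: v].
Proof.
move=> c0; rewrite /spec_rad => cE.
have [mu mur cmu] : exists2 mu, mu \in rootsR (char_poly (adj_mx R E)) & c < mu.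
  elim: (rootsR _) cE => [|x s IH]; first by rewrite big_nil ltNge c0.
  rewrite big_cons lt_max => /orP[cx|/IH[mu ms cmu]]; first by exists x; rewrite ?mem_head.
  by exists mu; rewrite // in_cons ms orbT.
have : root (char_poly (adj_mx R E)) mu by apply: root_roots mur.
rewrite -eigenvalue_root_char => /eigenvalueP[v vE v0].
by exists mu, v.
Qed.

Lemma adjacent_sym (n : nat) (E : {set {set 'I_n}}) : symmetric (adjacent E).
Proof. by move=> x y; rewrite /adjacent setUC. Qed.

Lemma adjacent_irr (n : nat) (E : {set {set 'I_n}}) :
  is_graph E -> forall x, adjacent E x x = false.
Proof.
move=> gE x; apply/negbTE/negP => /gE; rewrite setUid cards1 //.
Qed.

Lemma spec_rad_le_of_subinvariant (R : realType) (n : nat) (E : {set {set 'I_n}})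
    (z : 'I_n -> nat) (c : nat) :
  (forall i, 0 < z i)%N -> (forall i, \sum_j adjacent E i j * z j <= c * z i)%N ->
  spec_rad R E <= c%:R.
Proof.
move=> z0 Az; rewrite leNgt; apply/negP => cE.
have [//|mu [v [cmu v0 vE]]] := spec_rad_gt_eigenvector _ _ _ _ _ cE.
move: cmu; rewrite ltNge => /negP[].
apply: (eigenvalue_le_of_subinvariant _ _ _ (fun i => (z i)%:R) _ _ _ _ _ _ v0 vE).
- by move=> i j; rewrite mxE ler0n.
- by move=> i; rewrite ltr0n.
- move=> i; rewrite -natrM; under eq_bigr do rewrite mxE -natrM.
  by rewrite -natr_sum ler_nat.
Qed.

Lemma sum_nat_bool_card (T : finType) (P : pred T) : (\sum_x P x = #|P|)%N.
Proof. by rewrite -sum1_card [RHS]big_mkcond; apply: eq_bigr => x _; rewrite unfold_in; case: (P x). Qed.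

(** Next to an isolated vertex all degrees are at most [m], and constant weights bound the spectral
    radius by [m]. *)
Lemma no_isolated_vertex (R : realType) (m : nat) (E : {set {set 'I_m.+2}}) :
  is_graph E -> m%:R < spec_rad R E -> forall x, exists y, adjacent E x y.
Proof.
move=> gE big x; apply/existsP; apply: contraLR big => /existsPn iso.
rewrite -leNgt; apply: (spec_rad_le_of_subinvariant _ _ _ (fun=> 1%N)) => // i.
under eq_bigr do rewrite muln1.
rewrite muln1; have [->|ix] := eqVneq i x.
  by rewrite big1 // => j _; rewrite (negbTE (iso j)).
rewrite (bigD1 i) //= adjacent_irr // (bigD1 x) 1?eq_sym //= adjacent_sym (negbTE (iso i)) !add0n.
apply: leq_trans (_ : \sum_(j | (j != i) && (j != x)) 1 <= _)%N.
  by apply: leq_sum => j _; case: (adjacent E i j).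
rewrite sum1_card (eq_card (B := [predC [set i; x]])); last by move=> j; rewrite !inE negb_or.
by rewrite -(leq_add2l #|[set i; x]|) cardC cards2 ix card_ord.
Qed.

(* Hong's bound rho^2 <= 2e - (n-1): every row sum of A^2 is at most 2e - (n-1). *)
Lemma few_missing_pairs (R : realType) (m : nat) (E : {set {set 'I_m.+2}}) :
  is_graph E -> m%:R < spec_rad R E ->
  (\sum_x \sum_y (x != y) && ([set x; y] \notin E) <= 2 * m)%N.
Proof.
move=> gE big; have iso := no_isolated_vertex _ _ _ gE big.
pose A := adjacent E; pose d x := (\sum_y A x y)%N.
(* The rest of the degree sum comes from [i] and its non-neighbours: [d i] counts one per neighbour
   and each non-neighbour has degree at least 1, which makes [n-1 = m.+1]. *)
have rows i : (\sum_j A i j * d j + m.+1 <= \sum_j d j)%N.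
  have -> : (\sum_j d j = \sum_j A i j * d j + \sum_j ~~ A i j * d j)%N.
    by rewrite -big_split; apply: eq_bigr => j _; case: (A i j) => /=; lia.
  rewrite leq_add2l (bigD1 i) //= /A adjacent_irr // mul1n {1}/d (bigD1 i) //= /A adjacent_irr // add0n.
  rewrite -big_split /=.
  have {1}-> : m.+1 = (\sum_(j < m.+2 | j != i) 1)%N by rewrite sum1_card cardC1 card_ord.
  apply: leq_sum => j _; case Aij : (adjacent E i j) => //=; rewrite mul1n /d.
  by have [y jy] := iso j; rewrite (bigD1 y) //= /A jy.
have [//|mu [v [mmu v0 vE]]] := spec_rad_gt_eigenvector _ _ _ _ _ big.
have mu2 : mu ^+ 2 <= (\sum_j d j - m.+1)%N%:R.
  apply: (eigenvalue_le_of_subinvariant _ _ (adj_mx R E *m adj_mx R E) (fun=> 1) _ _ v) => //.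
  - by move=> i j; rewrite mxE; apply: sumr_ge0 => k _; rewrite !mxE -natrM ler0n.
  - move=> i /=; rewrite mulr1; under eq_bigr do rewrite mulr1 mxE.
    rewrite exchange_big /= (_ : \sum_j _ = (\sum_j A i j * d j)%N%:R); last first.
      rewrite natr_sum; apply: eq_bigr => j _; rewrite natrM natr_sum mulr_sumr.
      by apply: eq_bigr => k _; rewrite !mxE.
    by rewrite ler_nat; move: (rows i); move: (\sum_j _)%N (\sum_j _)%N => p q; lia.
  - by rewrite mulmxA vE -scalemxAl vE scalerA.
have m2 : (m * m < \sum_j d j - m.+1)%N.
  rewrite -(ltr_nat R); apply: lt_le_trans mu2.
  by rewrite natrM -expr2 ltrXn2r.
have split_all : (\sum_x \sum_y (x != y) && ([set x; y] \notin E) + \sum_j d j = m.+2 * m.+1)%N.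
  rewrite -big_split /= -[X in (X * _)%N](card_ord m.+2) -sum_nat_const; apply: eq_bigr => x _.
  rewrite /d -big_split /= -[RHS](_ : #|predC1 x| = _); last by rewrite cardC1 card_ord.
  rewrite -sum_nat_bool_card; apply: eq_bigr => y _ /=.
  rewrite /A /adjacent.
  have [<-|xy] := eqVneq x y; first by rewrite -/(adjacent E x x) adjacent_irr.
  by case: (_ \in E).
(* By integrality the degree sum is at least [m^2 + m + 2], and [(m+2)(m+1)] exceeds this by
   [2m]. *)
move: m2 split_all; move: (\sum_x _)%N (\sum_j _)%N => p q; nia.
Qed.

(** The graph is the join of an edge with three independent vertices; its Perron vector is 2 on [T]
    and 3 elsewhere, with eigenvalue 3. *)
Lemma spec_rad_triangle_complement (R : realType) (E : {set {set 'I_5}}) (T : {set 'I_5}) :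
  is_graph E -> #|T| = 3%N ->
  (forall s t, s != t -> adjacent E s t = ~~ ((s \in T) && (t \in T))) ->
  spec_rad R E <= 3.
Proof.
move=> gE T3 ET; apply: (spec_rad_le_of_subinvariant _ _ _ (fun s => if s \in T then 2 else 3)%N).
  by move=> i; case: ifP.
move=> i; rewrite (bigD1 i) //= adjacent_irr // add0n.
have TC : (\sum_(t | t \notin T) 3 = 6)%N.
  rewrite sum_nat_const (eq_card (B := ~: T)); last by move=> t; rewrite inE.
  by have := cardsC T; rewrite T3 card_ord; lia.
have TT : (\sum_(t in T) 2 = 6)%N by rewrite sum_nat_const T3.
have [iT|iT] := boolP (i \in T).
  rewrite (_ : 3 * 2 = 6)%N // -[X in (_ <= X)%N]TC [X in (_ <= X)%N]big_mkcond [X in (X <= _)%N]big_mkcond /=.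
  apply: leq_sum => t _; case: eqVneq => //= ti; rewrite ET 1?eq_sym // iT.
  by case: (t \in T).
have -> : (3 * 3 = 6 + (6 - 3))%N by [].
rewrite -{1}TT -TC (bigD1 i iT) /= addKn.
rewrite [X in (X <= _)%N](bigID (mem T)) /=; apply: leq_add.
  rewrite [X in (_ <= X)%N]big_mkcond [X in (X <= _)%N]big_mkcond /=.
  by apply: leq_sum => t _; case: (t \in T); case: (t != i); case: (adjacent E i t).
rewrite [X in (_ <= X)%N]big_mkcond [X in (X <= _)%N]big_mkcond /=.
by apply: leq_sum => t _; case: (t \in T); case: (t != i); case: (adjacent E i t).
Qed.

(** * The pendant clique and the conclusion *)

Lemma pendant_cliqueE (m : nat) (a b : 'I_m.+3) : a != b ->
  ([set a; b] \in pendant_clique m.+3) =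
  ~~ ((a == ord_max) && (b != ord0) || (b == ord_max) && (a != ord0)).
Proof.
move=> ab; rewrite inE cards2 ab /=.
have P (Q : pred 'I_m.+3) : [forall x in [set a; b], Q x] = Q a && Q b.
  apply/forall_inP/andP => [h|[Qa Qb] x]; first by rewrite !h ?set21 ?set22.
  by rewrite !inE => /orP[] /eqP->.
rewrite (P (fun x => (x < m.+2)%N)) (P (fun x => (val x == 0%N) || (val x == m.+2))).
move: ab; rewrite -!(inj_eq val_inj) /=.
by have := (ltn_ord a, ltn_ord b); move: (nat_of_ord a) (nat_of_ord b) => p q [? ?] ?; lia.
Qed.

(** Here [y] is the pendant vertex and [z] its only neighbour, so a permutation with [ord_max] going
    to [y] and [ord0] to [z] is an isomorphism. *)
Lemma pendant_graph_iso (m : nat) (E : {set {set 'I_m.+3}}) (y z : 'I_m.+3) :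
  is_graph E -> y != z ->
  (forall s t, s != t ->
    ([set s; t] \in E) = ~~ ((s == y) && (t != z) || (t == y) && (s != z))) ->
  graph_iso E (pendant_clique m.+3).
Proof.
move=> gE yz adjE; have [|p [p0 pm]] := perm_map2 _ ord_max ord0 _ _ _ yz => //.
exists p; apply/setP => e.
have eE : e = p @: ((p^-1)%g @: e).
  by rewrite -imset_comp -[LHS]imset_id; apply: eq_imset => x /=; rewrite permKV.
rewrite [in RHS]eE mem_imset; last exact: imset_inj perm_inj.
have [/cards2P[s [t [st ->]]]|e2] := boolP (#|e| == 2).
  rewrite adjE // imsetU !imset_set1 pendant_cliqueE ?(inj_eq perm_inj) //.
  have pE (x : 'I_m.+3) r : ((p^-1)%g x == r) = (x == p r).
    by rewrite -(inj_eq (@perm_inj _ p)) permKV.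
  by rewrite !pE p0 pm.
rewrite inE card_imset ?(negbTE e2) /=; last exact: perm_inj.
by apply: contraNF e2 => /gE->.
Qed.

Theorem mainTheorem2 (R : realType) (n : nat) (G : 'I_n -> {set {set 'I_n}}) :
  (4 <= n)%N ->
  (forall i, is_graph (G i)) ->
  (forall i, (n - 2)%:R < spec_rad R (G i)) ->
  rainbow_ham_cycle G \/
  ((forall i j, G i = G j) /\ (forall i, graph_iso (G i) (pendant_clique n))).
Proof.
case: n G => [|[|[|[|m]]]] // G _ gG big.
rewrite !subSS subn0 in big.
pose B (i : 'I_m.+4) : rel 'I_m.+4 := fun x y => (x != y) && ([set x; y] \notin G i).
have BE i s t : s != t -> ([set s; t] \in G i) = ~~ B i s t.
  by move=> st; rewrite /B st negbK.
have BC i : symmetric (B i) by move=> x y; rewrite /B setUC eq_sym.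
have B0 i x : B i x x = false by rewrite /B eqxx.
have [[v [s vs]]|[[y z] /= yz Byz]|[m1 [T T3 BT]]] :=
    rainbow_dichotomy _ _ BC B0 (fun i => few_missing_pairs _ _ _ (gG i) (big i)).
- left; exists v, (s)%g => k; rewrite BE ?vs //.
  by rewrite (inj_eq perm_inj) eq_sym ordS_neq.
- right; split=> [i j|i].
    apply/setP => e; have [/cards2P[s [t [st ->]]]|e2] := boolP (#|e| == 2).
      by rewrite !BE // !Byz.
    by apply/idP/idP => /gG e2'; rewrite e2' in e2.
  apply: (pendant_graph_iso _ _ y z) => // s t st; rewrite BE // Byz //.
(* Here [n = 5], and spectral radius at most 3 contradicts the strict bound [n-2]. *)
- subst m; have := big ord0; rewrite ltNge => /negP[].
  apply: (spec_rad_triangle_complement _ _ T) => // s t st.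
  by rewrite /adjacent BE // BT.
Qed.
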